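(* For a $d\times d$ block homogeneous correlation matrix $P$ with $S$ groups of sizes $d_1,\dots,d_S$, $d=d_1+\cdots+d_S$, its Cholesky factor $L$ is of the form $$L=\begin{pmatrix}L_{11}&O&\cdots&O\\ L_{21}&L_{22}&\ddots&O\\ \vdots&\vdots&\ddots&\vdots\\ L_{S1}&L_{S2}&\cdots&L_{SS}\end{pmatrix},$$ where $O$ represents a block of zeros and, for $s=1,\dots,S$, the diagonal blocks are $$L_{ss}=\begin{pmatrix}\tilde l_{ss,1}&0&0&\cdots&0\\ l_{ss,1}&\tilde l_{ss,2}&0&&\vdots\\ l_{ss,1}&l_{ss,2}&\tilde l_{ss,3}&\ddots&\vdots\\ \vdots&\vdots&\vdots&\ddots&0\\ l_{ss,1}&l_{ss,2}&l_{ss,3}&\cdots&\tilde l_{ss,d_s}\end{pmatrix}\in\mathbb{R}^{d_s\times d_s}$$ for some $\tilde l_{ss,k}$, $k=1,\dots,d_s$, and $l_{ss,k}$, $k=1,\dots,d_s-1$, and the off-diagonal blocks are $$L_{s+m,s}=(c_{sm,1}\boldsymbol{1}_{d_{s+m}},\dots,c_{sm,d_s}\boldsymbol{1}_{d_{s+m}})\in\mathbb{R}^{d_{s+m}\times d_s},\quad m=1,\dots,S-s,$$ for some $(c_{sm,1},\dots,c_{sm,d_s})$.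
   Context: A block homogeneous matrix is a symmetric matrix in $[-1,1]^{d\times d}$ with unit diagonal of the form $P=(P_{s_1s_2})_{s_1,s_2=1}^S$ with blocks $P_{ss}=(1-\rho_{ss})I_{d_s}+\rho_{ss}J_{d_s}$ and, for $s_1\neq s_2$, $P_{s_1s_2}=\rho_{s_1s_2}J_{d_{s_1}d_{s_2}}$, where $I_n$ is the $n\times n$ identity matrix, $J_{nm}$ the $n\times m$ matrix of ones, $J_n=J_{nn}$, and $\rho_{s_1s_2}=\rho_{s_2s_1}$. It is a block homogeneous correlation matrix if it is in addition a correlation matrix, that is, positive semi-definite. The Cholesky decomposition of a positive definite (positive semi-definite) matrix $P$ is $P=LL^\top$ for a lower triangular matrix $L$ with positive (non-negative) diagonal elements; $L$ is called the Cholesky factor of $P$. $\boldsymbol{1}_n\in\mathbb{R}^n$ denotes the column vector of ones.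
   Formalization: For singular P the Cholesky factor is not unique and the claim can fail; there ''its Cholesky factor'' is taken to be one whose columns with zero diagonal entry vanish (shown to exist). For positive definite P the claim holds for every Cholesky factor. *)

(* Defs.v *)
From HB Require Import structures.
From mathcomp Require Import all_boot all_order all_algebra.

Set Implicit Arguments.
Unset Strict Implicit.
Unset Printing Implicit Defensive.

Import Order.TTheory GRing.Theory Num.Theory.
Local Open Scope ring_scope.

Section Matrices.
Variable R : rcfType.

Definition psdmx n (A : 'M[R]_n) : Prop :=
  A^T = A /\ forall x : 'cV[R]_n, 0 <= (x^T *m A *m x) 0 0.

Definition pdmx n (A : 'M[R]_n) : Prop :=
  A^T = A /\ forall x : 'cV[R]_n, x != 0 -> 0 < (x^T *m A *m x) 0 0.

(* The diagonal is required to be positive exactly when A is positive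
   definite; for a merely positive semi-definite A it is only nonnegative. *)
Definition cholesky_factor n (A L : 'M[R]_n) : Prop :=
  [/\ is_trig_mx L,
      forall i, 0 <= L i i,
      pdmx A -> forall i, 0 < L i i
    & A = L *m L^T].

(* A singular positive semi-definite matrix can have several Cholesky factors.
   The Cholesky algorithm selects the one whose columns with zero pivot vanish;
   the condition is vacuous when the diagonal is positive. *)
Definition zero_pivot_zero_col n (L : 'M[R]_n) : Prop :=
  forall j, L j j = 0 -> col j L = 0.

Section Blocks.
Variables (S : nat) (d : 'I_S -> nat).

(* rho s s is immaterial when d s = 1. *)
Definition block_homogeneous (P : 'M[R]_(\sum_(s < S) d s)) : Prop :=
  [/\ P^T = P,
      forall i j, -1 <= P i j <= 1,
      forall i, P i i = 1
    & exists2 rho : 'M[R]_S, rho^T = rho &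
        (forall s, submxblock P s s =
           (1 - rho s s) *: 1%:M + rho s s *: const_mx 1) /\
        (forall s1 s2, s1 != s2 ->
           submxblock P s1 s2 = rho s1 s2 *: const_mx 1)].

Definition block_homogeneous_correlation
    (P : 'M[R]_(\sum_(s < S) d s)) : Prop :=
  block_homogeneous P /\ psdmx P.

(* lt and l hold the diagonal and the subdiagonal column values of a diagonal
   block; the last entry of l is not used.  In the off-diagonal block (s2, s1),
   c depends on both s1 and s2. *)
Definition block_cholesky_form (L : 'M[R]_(\sum_(s < S) d s)) : Prop :=
  [/\ forall s1 s2 : 'I_S, (s1 < s2)%N -> submxblock L s1 s2 = 0,
      forall s : 'I_S, exists lt l : 'rV[R]_(d s),
        submxblock L s s =
          \matrix_(i, j) (if i == j then lt 0 j
                          else if (j < i)%N then l 0 j else 0)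
    & forall s1 s2 : 'I_S, (s1 < s2)%N ->
        exists c : 'rV[R]_(d s1), submxblock L s2 s1 = \matrix_(i, k) c 0 k].

End Blocks.
End Matrices.

(* Main.v *)
Require Import Defs.
From mathcomp Require Import all_boot all_order all_algebra.
From mathcomp Require Import ring.

Import Order.TTheory GRing.Theory Num.Theory.

Local Open Scope ring_scope.

(** Write [P = L L^T] with [L] lower triangular.  For [k < i],
    [P i k = L i k * L k k + \sum_(m < k) L i m * L k m].  If two rows [i], [j]
    below [k] satisfy [P i m = P j m] for all [m <= k], then, by strong
    induction on [k], the sums for [i] and [j] coincide, so
    [L i k * L k k = L j k * L k k].  Hence [L i k = L j k]: cancel the pivot
    [L k k], or, if it is zero, use that column [k] of [L] vanishes
    ([cholesky_rows_agree]).

    In a block homogeneous matrix, rows [i] and [j] of the same group agree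
    outside columns [i] and [j] ([block_homogeneous_row]).  So strictly below the
    diagonal each column of [L] is constant on every group of rows, which is
    the announced form, both inside and outside the diagonal blocks.

    A factor whose zero-pivot columns vanish exists for every positive
    semi-definite matrix: take the square root of the first pivot and recurse
    on the Schur complement, which is again positive semi-definite
    ([psdmx_cholesky_exists]).  A factor of a positive definite matrix has
    nonzero determinant, hence no zero pivot. *)

Section Existence.

Set Implicit Arguments.
Unset Strict Implicit.

Context {R : rcfType}.

(** The quadratic form of a matrix with scalar pivot [a], as a polynomial in
    the first coordinate [t] of the vector. *)
Lemma quad_form_block n (a t : R) (b x : 'cV[R]_n) (C : 'M[R]_n) :
  ((col_mx t%:M x)^T *m block_mx a%:M b^T b C *m col_mx t%:M x) 0 0 =
  t ^+ 2 * a + 2 * t * (b^T *m x) 0 0 + (x^T *m C *m x) 0 0.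
Proof.
have xb : x^T *m b = (b^T *m x)^T by rewrite trmx_mul trmxK.
rewrite -mulmxA mul_block_col tr_col_mx mul_row_col tr_scalar_mx.
rewrite !mul_scalar_mx mul_mx_scalar mulmxDr -scalemxAr xb mulmxA.
move: (b^T *m x) (x^T *m C *m x) => q r; rewrite !mxE eqxx mulr1n; ring.
Qed.

Lemma psdmx_block_pivot_ge0 n (a : R) (b : 'cV[R]_n) (C : 'M[R]_n) :
  psdmx (block_mx a%:M b^T b C) -> 0 <= a.
Proof.
case=> _ /(_ (col_mx 1%:M 0)); rewrite quad_form_block !mulmx0 !mxE.
by rewrite expr1n mul1r mulr0 !addr0.
Qed.

Lemma psdmx_block_pivot0 n (b : 'cV[R]_n) (C : 'M[R]_n) :
  psdmx (block_mx 0%:M b^T b C) -> b = 0.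
Proof.
case=> _ psd; suff bx (x : 'cV[R]_n) : (b^T *m x) 0 0 = 0.
  apply/matrixP=> i j; rewrite ord1 !mxE -(bx (delta_mx i 0)) -colE.
  by rewrite !mxE.
apply/eqP; apply/negPn/negP => nz.
set q := (b^T *m x) 0 0 in nz; set r := (x^T *m C *m x) 0 0.
(* The form is affine in t with slope 2 q: this t makes it equal to -1. *)
have := psd (col_mx (- (r + 1) / (2 * q))%:M x).
rewrite quad_form_block -/q -/r mulr0 add0r.
have -> : 2 * (- (r + 1) / (2 * q)) * q + r = -1 by field.
by rewrite oppr_ge0 ler10.
Qed.

(** The Schur complement of the pivot [a].  When [a = 0] the quotient is zero
    by convention, which is harmless because [b] vanishes too. *)
Lemma psdmx_schur n (a : R) (b : 'cV[R]_n) (C : 'M[R]_n) :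
  psdmx (block_mx a%:M b^T b C) -> psdmx (C - a^-1 *: (b *m b^T)).
Proof.
move=> psdA; have b0 : a = 0 -> b = 0.
  by move=> a0; rewrite a0 in psdA; apply: (psdmx_block_pivot0 psdA).
case: psdA => symA psdA; split.
  move: symA; rewrite tr_block_mx => /eq_block_mx[_ _ _ symC].
  by rewrite linearB linearZ /= trmx_mul trmxK symC.
move=> x; set q := (b^T *m x) 0 0.
(* This first coordinate minimises the form of the whole matrix. *)
have := psdA (col_mx (- (q / a))%:M x); rewrite quad_form_block -/q.
have -> : (x^T *m (C - a^-1 *: (b *m b^T)) *m x) 0 0 =
          (x^T *m C *m x) 0 0 - a^-1 * q ^+ 2.
  have bx : b^T *m x = q%:M by rewrite [LHS]mx11_scalar.
  have xb : x^T *m b = q%:M by rewrite -[b]trmxK -trmx_mul bx tr_scalar_mx.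
  have bb : x^T *m (b *m b^T) *m x = (q ^+ 2)%:M.
    by rewrite mulmxA -mulmxA xb bx -scalar_mxM.
  rewrite mulmxBr mulmxBl -scalemxAr -scalemxAl bb.
  by move: (x^T *m C *m x) => r; rewrite !mxE eqxx mulr1n.
have [a0|a0] := eqVneq a 0.
  have -> : q = 0 by rewrite /q b0 // trmx0 mul0mx mxE.
  by congr (0 <= _); ring.
by congr (0 <= _); field.
Qed.

(** One step of the induction factors
    [[a, b^T], [b, C]] with first column [(l, b / l)], [l = sqrt a]; when
    [a = 0], both [b] and [l^-1] are zero and so is this column. *)
Lemma psdmx_cholesky_exists n (A : 'M[R]_n) : psdmx A ->
  exists L : 'M[R]_n, [/\ is_trig_mx L, forall i, 0 <= L i i,
    zero_pivot_zero_col L & A = L *m L^T].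
Proof.
elim: n A => [|n IHn] A psdA.
  exists 0; split; first by apply/is_trig_mxP=> [[]].
  - by case.
  - by case.
  - by apply/matrixP=> [[]].
rewrite -[n.+1]/(1 + n)%N in A psdA *.
have [a [b [C eA]]] : exists a b C, A = block_mx a%:M b^T b C.
  have symA := psdA.1.
  exists (A 0 0), (dlsubmx A), (drsubmx A).
  rewrite -[LHS]submxK; congr block_mx.
    by rewrite [LHS]mx11_scalar !mxE lshift0.
  by rewrite trmx_dlsub symA.
rewrite eA in psdA *.
have a_ge0 := psdmx_block_pivot_ge0 psdA.
have [L' [trigL' geL' zpL' eL']] := IHn _ (psdmx_schur psdA).
pose l := Num.sqrt a; pose w := l^-1 *: b.
have ll : l * l = a by rewrite -expr2 sqr_sqrtr.
have lw : l *: w = b.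
  rewrite scalerA; have [l0|l0] := eqVneq l 0; last by rewrite divff // scale1r.
  rewrite l0 mul0r scale0r; have a0 : a = 0 by rewrite -ll l0 mul0r.
  by rewrite a0 in psdA; rewrite (psdmx_block_pivot0 psdA).
exists (block_mx l%:M 0 w L'); split.
- by rewrite is_trig_block_mx // eqxx trigL' scalar_mx_is_trig.
- move=> i; case: (split_ordP i) => j ->.
    by rewrite block_mxEul ord1 mxE sqrtr_ge0.
  by rewrite block_mxEdr.
- move=> j; case: (split_ordP j) => k ->{j}.
    rewrite block_mxEul [k]ord1 mxE eqxx mulr1n => l0.
    apply/colP=> i; rewrite mxE [RHS]mxE; case: (split_ordP i) => h ->{i}.
      by rewrite block_mxEul mxE l0 mul0rn.
    by rewrite block_mxEdl mxE l0 invr0 mul0r.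
  rewrite block_mxEdr => /zpL' /colP col0.
  apply/colP=> i; rewrite mxE [RHS]mxE; case: (split_ordP i) => h ->{i}.
    by rewrite block_mxEur mxE.
  by rewrite block_mxEdr; have := col0 h; rewrite !mxE.
rewrite tr_block_mx mulmx_block !trmx0 !mulmx0 !mul0mx !addr0 -eL'.
rewrite tr_scalar_mx -scalar_mxM ll mul_scalar_mx mul_mx_scalar -linearZ /=.
rewrite lw; congr block_mx.
by rewrite linearZ /= -scalemxAl -scalemxAr scalerA -invfM ll addrC subrK.
Qed.

(** A zero pivot makes [L] singular, and a vector [v] with [v L = 0]
    annihilates the quadratic form of [L L^T]. *)
Lemma pdmx_cholesky_pivot_neq0 n (L : 'M[R]_n) :
  is_trig_mx L -> pdmx (L *m L^T) -> forall i, L i i != 0.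
Proof.
move=> trigL [_ pd] i; apply/eqP => Li0.
have /det0P[v v0 vL0] : \det L == 0.
  by rewrite det_trig // (bigD1 i) //= Li0 mul0r.
have := pd v^T; rewrite trmxK trmx_eq0 v0 mulmxA vL0 !mul0mx mxE ltxx.
by move/(_ isT).
Qed.

End Existence.

Section Form.

Set Implicit Arguments.
Unset Strict Implicit.

Context {R : rcfType}.

(** An entry of a Cholesky factor strictly below the diagonal depends on its
    row only through the entries of that row of the factored matrix up to the
    same column. *)
Lemma cholesky_rows_agree n (L : 'M[R]_n) :
  is_trig_mx L -> zero_pivot_zero_col L ->
  forall i j k : 'I_n, (k < i)%N -> (k < j)%N ->
  (forall m : 'I_n, (m <= k)%N -> (L *m L^T) i m = (L *m L^T) j m) ->
  L i k = L j k.
Proof.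
move=> /is_trig_mxP trigL zpL i j k.
have [h] := ubnP (k : nat); elim: h k => // h IHh k kh ki kj eq_rows.
have [/zpL/colP Lk0|Lk_neq0] := eqVneq (L k k) 0.
  by have := Lk0 i; have := Lk0 j; rewrite !mxE => -> ->.
have := eq_rows k (leqnn k); rewrite !mxE (bigD1 k) //= [RHS](bigD1 k) //= !mxE.
set X := (X in _ + X = _); set Y := (Y in _ = _ + Y).
have -> : X = Y.
  apply: eq_bigr => m m_neq_k; rewrite !mxE.
  have [mk|km] := ltnP m k; last first.
    by rewrite (trigL k m) ?mulr0 // ltn_neqAle eq_sym m_neq_k.
  congr (_ * _); apply: IHh.
  - exact: leq_trans mk kh.
  - exact: ltn_trans mk ki.
  - exact: ltn_trans mk kj.
  - by move=> p pm; apply: eq_rows; apply: leq_trans pm (ltnW mk).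
by move/addIr/(mulIf Lk_neq0).
Qed.

Lemma block_homogeneous_row S (d : 'I_S -> nat) (P : 'M[R]_(\sum_(s < S) d s))
    s (i j : 'I_(d s)) (m : 'I_(\sum_(s < S) d s)) :
  block_homogeneous P -> m != tagnat.Rank s i -> m != tagnat.Rank s j ->
  P (tagnat.Rank s i) m = P (tagnat.Rank s j) m.
Proof.
case=> _ _ _ [rho _ [Pdiag Poff]].
rewrite -(tagnat.sig2K m); move: (tagnat.sig1 m) (tagnat.sig2 m) => t k.
have [st|st] := eqVneq s t.
  case: _ / st in k * => ki kj.
  have kNi : i != k by apply: contraNneq ki => ->.
  have kNj : j != k by apply: contraNneq kj => ->.
  have /matrixP Ps := Pdiag s; have := Ps i k; have := Ps j k.
  by rewrite !mxE (negPf kNi) (negPf kNj) => -> ->.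
move=> _ _; have /matrixP Pst := Poff _ _ st.
by have := Pst i k; have := Pst j k; rewrite !mxE => -> ->.
Qed.

Lemma ltn_Rank_block S (d : 'I_S -> nat) (s t : 'I_S)
    (i : 'I_(d s)) (j : 'I_(d t)) :
  (s < t)%N -> (tagnat.Rank s i < tagnat.Rank t j)%N.
Proof.
move=> st; rewrite ltnNge; apply/negP => ji.
have : (tagnat.Rank t j <= tagnat.Rank s i)%O by [].
by move/tagnat.le_sig1; rewrite !tagnat.Rank1K leEord leqNgt st.
Qed.

(** No positivity is needed here: triangularity and the vanishing of the
    zero-pivot columns suffice. *)
Lemma block_homogeneous_cholesky_form S (d : 'I_S -> nat)
    (L : 'M[R]_(\sum_(s < S) d s)) :
  block_homogeneous (L *m L^T) -> is_trig_mx L -> zero_pivot_zero_col L ->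
  block_cholesky_form L.
Proof.
move=> homP trigL zpL; have /is_trig_mxP L0 := trigL.
have rows s (i j : 'I_(d s)) (k : 'I_(\sum_(s < S) d s)) :
    (k < tagnat.Rank s i)%N -> (k < tagnat.Rank s j)%N ->
    L (tagnat.Rank s i) k = L (tagnat.Rank s j) k.
  move=> ki kj; apply: cholesky_rows_agree => // m mk.
  apply: block_homogeneous_row => //; rewrite -val_eqE /= neq_ltn.
    by rewrite (leq_ltn_trans mk ki).
  by rewrite (leq_ltn_trans mk kj).
have ltR s (i j : 'I_(d s)) : (tagnat.Rank s i < tagnat.Rank s j)%N = (i < j)%N.
  exact: tagnat.lt_Rank.
split.
- move=> s t st; apply/matrixP => i j; rewrite !mxE.
  by apply: L0; apply: ltn_Rank_block.
- move=> s; exists (\row_j L (tagnat.Rank s j) (tagnat.Rank s j)).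
  (* Any row below the diagonal gives the common value of a column. *)
  exists (\row_j if [pick i : 'I_(d s) | (j < i)%N] is Some i
                 then L (tagnat.Rank s i) (tagnat.Rank s j) else 0).
  apply/matrixP => i j; rewrite !mxE.
  have [-> //|ij] := eqVneq i j.
  have [ji|ij'] := ltnP j i; last by apply: L0; rewrite ltR ltn_neqAle ij.
  case: pickP => [i' ji'|/(_ i)]; last by rewrite ji.
  by apply: rows; rewrite ltR.
- (* If the group t is empty, any c will do. *)
  move=> s t st; have [i0|none] := pickP (fun _ : 'I_(d t) => true).
    move=> _; exists (\row_k L (tagnat.Rank t i0) (tagnat.Rank s k)).
    by apply/matrixP => i k; rewrite !mxE; apply: rows; apply: ltn_Rank_block.
  by exists 0; apply/matrixP => i; have := none i.
Qed.

End Form.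

Theorem proposition7 (R : rcfType) (S : nat) (hS : (0 < S)%N)
    (d : 'I_S -> nat) (hd : forall s, (0 < d s)%N)
    (P : 'M[R]_(\sum_(s < S) d s))
    (hP : block_homogeneous_correlation P) :
  [/\ exists2 L, cholesky_factor P L & zero_pivot_zero_col L,
      forall L, cholesky_factor P L -> zero_pivot_zero_col L ->
        block_cholesky_form L
    & pdmx P -> forall L, cholesky_factor P L -> block_cholesky_form L].
Proof.
case: hP => homP psdP; split.
- have [L [trigL L_ge0 zpL eP]] := psdmx_cholesky_exists psdP.
  exists L => //; split=> // pdP i; rewrite lt0r L_ge0 andbT.
  by rewrite eP in pdP; apply: pdmx_cholesky_pivot_neq0.
- move=> L [trigL _ _ eP] zpL; rewrite eP in homP.
  exact: block_homogeneous_cholesky_form.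
- move=> pdP L [trigL _ L_gt0 eP]; rewrite eP in homP.
  apply: block_homogeneous_cholesky_form => // j Lj0.
  by have := L_gt0 pdP j; rewrite Lj0 ltxx.
Qed.
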